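(* For all $p\in[1,2]$ and $\varepsilon,\delta\in(0,1/4)$, any algorithm for dynamic trace estimation under a Schatten-$p$ norm assumption (with parameters $m$, $\alpha$, $\varepsilon$, $\delta$) must use at least $$\Omega\!\left(m\min\!\left(1,\frac{\alpha}{\varepsilon}\right)\frac{\log(1/\delta)}{k+\log\log(1/\delta)}\right)$$ matrix-vector multiplication queries, where each entry of the query vectors is specified by $k$ bits.
   Context: Dynamic trace estimation under a Schatten-$p$ norm assumption: the input is a sequence of real $n\times n$ matrices ${\bm{A}}_1,\dots,{\bm{A}}_m$ with $\|{\bm{A}}_i\|_p\le 1$ for all $i$ and $\|{\bm{A}}_{i+1}-{\bm{A}}_i\|_p\le\alpha<1$ for all $i\le m-1$, where $\|\cdot\|_p$ is the Schatten-$p$ norm ($\ell_p$ norm of the singular values). The algorithm accesses the matrices only via matrix-vector products ${\bm{A}}_j x$ (queries may be adaptive), and for each $i\in[m]$ must output, using queries to ${\bm{A}}_1,\dots,{\bm{A}}_i$, an estimate $t_i$ with $|t_i-\operatorname{tr}({\bm{A}}_i)|\le\varepsilon$ with probability at least $1-\delta$. The query complexity is the total number of matrix-vector products over all steps. Each entry of each query vector is specified using $k$ bits. *)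

(* Defs.v *)
From HB Require Import structures.
From mathcomp Require Export all_boot all_order all_algebra.
From mathcomp Require Import spectral complex.
From mathcomp Require Export all_classical all_reals all_analysis.

Set Implicit Arguments.
Unset Strict Implicit.
Unset Printing Implicit Defensive.
Import Order.TTheory GRing.Theory Num.Theory.
Local Open Scope ring_scope.

Section Schatten.
Variable R : realType.

(* The Gram matrix A^T A is taken over R[i] because the spectral theorem of the
   library (spectral_diag) lives over numClosedFieldType. *)
Definition gramC (n : nat) (A : 'M[R]_n) : 'M[R[i]]_n :=
  map_mx (real_complex R) (A^T *m A).

(* spectral_diag is junk on non-normal matrices; it is only used on gramC. *)
Lemma gramC_hermsymmx (n : nat) (A : 'M[R]_n) : gramC A \is hermsymmx.
Proof.
apply/is_hermitianmxP; rewrite expr0 scale1r; apply/matrixP => i j.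
rewrite !mxE conj_Creal ?Creal_real //; last by apply/complex_realP; eexists.
by congr (real_complex R _); apply: eq_bigr => l _; rewrite !mxE mulrC.
Qed.

Lemma gramC_normalmx (n : nat) (A : 'M[R]_n) : gramC A \is normalmx.
Proof. exact/hermitian_normalmx/gramC_hermsymmx. Qed.

(* Square roots of the eigenvalues of A^T A, with multiplicity. *)
Definition singular_value (n : nat) (A : 'M[R]_n) (i : 'I_n) : R :=
  Num.sqrt (complex.Re (spectral_diag (gramC A) ord0 i)).

Definition schatten_norm (p : R) (n : nat) (A : 'M[R]_n) : R :=
  (\sum_(i < n) singular_value A i `^ p) `^ p^-1.

End Schatten.

Section DynamicTrace.
Variables (R : realType) (n m : nat).

(* Matrices are numbered from 0: A j stands for A_{j+1}. *)
Definition dynamic_input (p alpha : R) (A : 'I_m -> 'M[R]_n) : Prop :=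
  (forall i, schatten_norm p (A i) <= 1) /\
  (forall i j : 'I_m, j = i.+1 :> nat ->
     schatten_norm p (A j - A i) <= alpha).

(* Entries are k-bit fixed-point numbers: integers of magnitude at most 2^k,
   up to one scale factor h shared by all the entries of the vector. *)
Definition kbit_vector (k : nat) (x : 'cV[R]_n) : Prop :=
  exists (h : R) (z : 'cV[int]_n),
    (forall i, (`|z i ord0| <= 2 ^ k)%N) /\ x = h *: map_mx intr z.

(* A deterministic adaptive algorithm. [Query j x next] asks for A_j x and goes
   on with [next (A_j x)]; [Emit t next] outputs the estimate of the current
   step and moves to the next step. *)
Inductive algo : Type :=
| Halt
| Query (j : 'I_m) (x : 'cV[R]_n) (next : 'cV[R]_n -> algo)
| Emit (t : R) (next : algo).

(* [legal k i a]: started in step i, [a] emits the estimates of steps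
   i, ..., m-1 in order, queries in each step only matrices already revealed,
   and uses only k-bit query vectors. *)
Fixpoint legal (k i : nat) (a : algo) : Prop :=
  match a with
  | Halt => i = m
  | Query j x next =>
      [/\ (j <= i)%N, kbit_vector k x & forall y, legal k i (next y)]
  | Emit _ next => legal k i.+1 next
  end.

Fixpoint estimates (A : 'I_m -> 'M[R]_n) (a : algo) : seq R :=
  match a with
  | Halt => [::]
  | Query j x next => estimates A (next (A j *m x))
  | Emit t next => t :: estimates A next
  end.

Fixpoint num_queries (A : 'I_m -> 'M[R]_n) (a : algo) : nat :=
  match a with
  | Halt => 0
  | Query j x next => (num_queries A (next (A j *m x))).+1
  | Emit _ next => num_queries A next
  end.

Definition estimate (A : 'I_m -> 'M[R]_n) (a : algo) (i : 'I_m) : R :=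
  nth 0 (estimates A a) i.

(* A randomized algorithm is a deterministic one for each outcome w of the
   coins. The success probability is required for each step separately. *)
Definition solves_dynamic_trace (p alpha eps delta : R) (k : nat)
    (d : measure_display) (T : measurableType d) (P : probability T R)
    (alg : T -> algo) : Prop :=
  (forall w, legal k 0 (alg w)) /\
  (forall A : 'I_m -> 'M[R]_n, dynamic_input p alpha A -> forall i : 'I_m,
     measurable_fun [set: T] (fun w => estimate A (alg w) i) /\
     ((1 - delta)%:E <=
        P [set w | (`|estimate A (alg w) i - \tr (A i)| <= eps)%R]%classic)%E).

Definition query_bound (p alpha : R) (T : Type) (alg : T -> algo) (Q : nat) :
    Prop :=
  forall A : 'I_m -> 'M[R]_n, dynamic_input p alpha A ->
    forall w, (num_queries A (alg w) <= Q)%N.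

End DynamicTrace.

(* Main.v *)
(* Compare the run on the all-zero input with the runs on single-bump inputs:
   matrices proportional to M = (e_u - e_v)(e_u - e_v)^T / 2, a rank-one
   projection, whose coefficient follows a triangular ramp of slope alpha and
   height > 2 eps around one of B ~ m min(1, alpha/eps) well-separated centers.
   A query x cannot distinguish such an input from 0 unless it falls inside the
   bump and x_u <> x_v. With k-bit entries, q queries colour the coordinates
   with K^q colours, K = 2^(k+1) + 1, so by Cauchy-Schwarz a fraction
   >= K^(-q) of the pairs (u, v) collide, and on those the estimate at the
   center is wrong for the zero input or for the bump. Hence most of the B
   disjoint blocks must receive of the order of log(1/delta) / (k+1) queries,
   and k+1 is at most a constant times k + log log(1/delta). *)
Require Import Defs.
From mathcomp Require Import spectral complex ring lra zify.
From mathcomp Require Import measurable_realfun.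

Set Implicit Arguments.
Unset Strict Implicit.
Unset Printing Implicit Defensive.
Import Order.TTheory GRing.Theory Num.Theory.
Local Open Scope ring_scope.

(** * Schatten norms of multiples of a rank-one projection *)

(** Unitary diagonalization carries [G *m G = a *: G] over to the spectrum, so each eigenvalue [s]
    solves [s ^+ 2 = a * s]. *)
Lemma spectral_diag_scaled_proj (C : numClosedFieldType) (n : nat)
    (G : 'M[C]_n) (a : C) :
  G \is normalmx -> G *m G = a *: G ->
  (forall i, spectral_diag G ord0 i = 0 \/ spectral_diag G ord0 i = a) /\
  \sum_i spectral_diag G ord0 i = \tr G.
Proof.
move=> /orthomx_spectralP; set U := spectralmx G; set s := spectral_diag G.
move=> GE GG; have Uu : U \in unitmx by exact/unitarymx_unit/spectral_unitarymx.
have DE : diag_mx s = U *m G *m invmx U.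
  by rewrite GE !mulmxA mulmxK // mulmxV // mul1mx.
have DD : diag_mx s *m diag_mx s = a *: diag_mx s.
  rewrite {1 2}DE !mulmxA mulmxKV // -(mulmxA U) GG DE.
  by rewrite -scalemxAr -scalemxAl.
split; last by rewrite -mxtrace_diag DE mxtrace_mulC mulmxA mulVmx // mul1mx.
move=> i; have := congr1 (fun X : 'M[C]_n => X i i) DD.
rewrite mulmx_diag !mxE eqxx !mulr1n => /eqP.
by rewrite -subr_eq0 -mulrBl mulf_eq0 subr_eq0 => /orP[] /eqP; [right | left].
Qed.

(** The Gram matrix of [c *: M] is [c ^+ 2 *: M], with eigenvalues 0 or [c ^+ 2]; for nonzero [c]
    the unit trace leaves exactly one nonzero singular value, so [p] drops out. *)
Lemma schatten_norm_scaled_proj (R : realType) (n : nat) (p c : R)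
    (M : 'M[R]_n) :
  0 < p -> M^T = M -> M *m M = M -> \tr M = 1 ->
  schatten_norm p (c *: M) = `|c|.
Proof.
move=> p0 MT MM trM.
have gE : gramC (c *: M) = real_complex R (c ^+ 2) *: map_mx (real_complex R) M.
  have cT : (c *: M)^T = c *: M by rewrite linearZ /= MT.
  rewrite /gramC cT -scalemxAl -scalemxAr MM scalerA -expr2.
  by rewrite map_mxZ.
have gg : gramC (c *: M) *m gramC (c *: M) =
    real_complex R (c ^+ 2) *: gramC (c *: M).
  by rewrite gE -scalemxAl -scalemxAr -map_mxM MM.
have [sE sT] := spectral_diag_scaled_proj (gramC_normalmx (c *: M)) gg.
pose b i : bool := spectral_diag (gramC (c *: M)) ord0 i != 0.
have sbE i : spectral_diag (gramC (c *: M)) ord0 i =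
    real_complex R (c ^+ 2 * (b i)%:R).
  rewrite /b; have [->|s0] := eqVneq; first by rewrite mulr0 rmorph0.
  by case: (sE i) s0 => -> ; rewrite ?eqxx // mulr1.
have svE i : singular_value (c *: M) i = `|c| * (b i)%:R.
  rewrite /singular_value sbE /=; case: (b i); last by rewrite !mulr0 sqrtr0.
  by rewrite !mulr1 sqrtr_sqr.
have sumb : c ^+ 2 * \sum_i (b i)%:R = c ^+ 2.
  apply: (fmorph_inj (real_complex R)); rewrite mulr_sumr rmorph_sum /=.
  under eq_bigr do rewrite -sbE.
  rewrite sT gE mxtraceZ.
  have -> : \tr (map_mx (real_complex R) M) = real_complex R (\tr M).
    by rewrite /mxtrace rmorph_sum; apply: eq_bigr => i _; rewrite mxE.
  by rewrite trM rmorph1 mulr1.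
rewrite /schatten_norm; under eq_bigr do rewrite svE.
have [c0|c0] := eqVneq c 0.
  rewrite big1 => [|i _]; last by rewrite c0 normr0 mul0r powR0 ?gt_eqF.
  by rewrite powR0 ?invr_eq0 ?gt_eqF // c0 normr0.
have -> : \sum_i (`|c| * (b i)%:R) `^ p = `|c| `^ p * \sum_i (b i)%:R.
  rewrite mulr_sumr; apply: eq_bigr => i _; case: (b i); rewrite ?mulr1 //.
  by rewrite !mulr0 powR0 ?gt_eqF.
have -> : \sum_i (b i)%:R = 1 :> R.
  by apply: (mulfI (expf_neq0 2 c0)); rewrite sumb mulr1.
by rewrite mulr1 -powRrM divff ?gt_eqF // powRr1.
Qed.

Definition pair_proj (R : realType) (n : nat) (u v : 'I_n) : 'M[R]_n :=
  2^-1 *: ((delta_mx u ord0 - delta_mx v ord0) *m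
           (delta_mx u ord0 - delta_mx v ord0 : 'cV[R]_n)^T).

Lemma tr_delta_diff_mul (R : realType) (n : nat) (u v : 'I_n) (x : 'cV[R]_n) :
  (delta_mx u ord0 - delta_mx v ord0 : 'cV[R]_n)^T *m x =
  (x u ord0 - x v ord0)%:M.
Proof.
rewrite linearB /= !trmx_delta mulmxBl -!rowE; apply/matrixP => i j.
by rewrite !ord1 !mxE mulr1n.
Qed.

Lemma pair_proj_mul (R : realType) (n : nat) (u v : 'I_n) (x : 'cV[R]_n) :
  pair_proj R u v *m x =
  (2^-1 * (x u ord0 - x v ord0)) *: (delta_mx u ord0 - delta_mx v ord0).
Proof.
rewrite /pair_proj -scalemxAl -mulmxA.
by rewrite tr_delta_diff_mul -scalerA mul_mx_scalar.
Qed.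

Lemma pair_proj_sym (R : realType) (n : nat) (u v : 'I_n) :
  (pair_proj R u v)^T = pair_proj R u v.
Proof. by rewrite /pair_proj linearZ /= trmx_mul trmxK. Qed.

Lemma pair_proj_idem (R : realType) (n : nat) (u v : 'I_n) : u != v ->
  pair_proj R u v *m pair_proj R u v = pair_proj R u v.
Proof.
move=> uv; rewrite {2}/pair_proj -scalemxAr mulmxA pair_proj_mul !mxE !eqxx.
rewrite (eq_sym v u) (negPf uv) /= -scalemxAl scalerA /pair_proj.
by congr (_ *: _); field.
Qed.

Lemma pair_proj_trace (R : realType) (n : nat) (u v : 'I_n) : u != v ->
  \tr (pair_proj R u v) = 1.
Proof.
move=> uv; rewrite /pair_proj mxtraceZ mxtrace_mulC.
rewrite tr_delta_diff_mul mxtrace_scalar mulr1n !mxE !eqxx.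
by rewrite (eq_sym v u) (negPf uv) /=; field.
Qed.

(** * Zero answers and k-bit queries *)

Section ZeroRun.
Variables (R : realType) (n m : nat).
Implicit Types (a : algo R n m) (A : 'I_m -> 'M[R]_n).

(** With all answers equal to 0 adaptivity disappears: the algorithm follows a single path with a
    fixed list of queries. *)
Fixpoint zero_queries a : seq ('I_m * 'cV[R]_n) :=
  match a with
  | Halt => [::]
  | Query j x next => (j, x) :: zero_queries (next 0)
  | Emit _ next => zero_queries next
  end.

Lemma size_zero_queries a :
  size (zero_queries a) = num_queries (fun=> 0) a.
Proof. by elim: a => //= j x next IH; rewrite mul0mx IH. Qed.

Lemma estimates_blind A a :
  (forall jx, List.In jx (zero_queries a) -> A jx.1 *m jx.2 = 0) ->
  estimates A a = estimates (fun=> 0) a.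
Proof.
elim: a => //= [j x next IH | t next IH] blind; last by rewrite IH.
rewrite mul0mx (blind (j, x)) /=; last by left.
by apply: IH => jx ?; apply: blind; right.
Qed.

Lemma zero_queries_kbit k i a : legal k i a ->
  forall jx, List.In jx (zero_queries a) -> kbit_vector k jx.2.
Proof.
elim: a i => //= [j x next IH | t next IH] i; last exact: IH.
by case=> _ kx lnext jx [<- //|]; apply: IH (lnext 0) _.
Qed.

(** A coordinate is coloured by the integers that the queries place there. The scale of a query is
    common to its entries, so equal integers give equal entries. *)
Lemma kbit_coloring k (s : seq 'cV[R]_n) :
  (forall x, List.In x s -> kbit_vector k x) ->
  exists (C : finType) (f : 'I_n -> C),
    #|C| = ((2 ^ k.+1).+1 ^ size s)%N /\
    forall u v, f u = f v ->
      forall x, List.In x s -> x u ord0 = x v ord0.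
Proof.
elim: s => [_|x s IH kxs].
  by exists unit, (fun=> tt); split; first rewrite card_unit.
have [|C [f [cardC fP]]] := IH; first by move=> y ?; apply: kxs; right.
have [h [z [zle xE]]] := kxs x (or_introl erefl).
(* The shift by [2 ^ k] lands in the range from 0 to [2 ^ k.+1], so neither [absz] nor [inord]
   merges two values. *)
pose g u : 'I_(2 ^ k.+1).+1 := inord (absz (z u ord0 + (2 ^ k)%N%:Z)).
exists ('I_(2 ^ k.+1).+1 * C)%type, (fun u => (g u, f u)); split.
  by rewrite /= card_prod card_ord cardC [RHS]expnS.
move=> u v [guv fuv] y [<-|]; last exact: fP fuv y.
have {}guv : absz (z u ord0 + (2 ^ k)%N%:Z) = absz (z v ord0 + (2 ^ k)%N%:Z).
  have := congr1 val guv.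
  rewrite /= !inordK //; have := zle u; have := zle v; rewrite expnS; lia.
have zuv : z u ord0 = z v ord0 by have := zle u; have := zle v; lia.
by rewrite xE !mxE zuv.
Qed.

End ZeroRun.

(** * Collision counting and averaging over the coins *)

(** Cauchy-Schwarz for the sizes [g y] of the colour classes: they add up to [#|T|], and their
    squares count the ordered pairs of equal colour. *)
Lemma card_collisions (R : realFieldType) (T C : finType) (f : T -> C) :
  #|T|%:R ^+ 2 <= #|C|%:R * \sum_u \sum_v (f u == f v)%:R :> R.
Proof.
pose g (y : C) : R := \sum_u (f u == y)%:R.
have sg : \sum_y g y = #|T|%:R.
  rewrite /g exchange_big /=; under eq_bigr => u _.
    rewrite (bigD1 (f u)) //= eqxx big1 ?addr0; last first.
      by move=> y /negPf; rewrite eq_sym => ->.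
    over.
  by rewrite sumr_const.
have sg2 : \sum_y g y ^+ 2 = \sum_u \sum_v (f u == f v)%:R.
  rewrite /g; under eq_bigr do rewrite expr2 mulr_suml.
  rewrite exchange_big /=; apply: eq_bigr => u _.
  rewrite (bigD1 (f u)) //= eqxx mul1r [X in _ + X]big1 ?addr0.
    by apply: eq_bigr => v _; rewrite eq_sym.
  by move=> y /negPf; rewrite eq_sym => ->; rewrite mul0r.
rewrite -sg2 -sg; set N : R := #|C|%:R; set S := \sum_y g y.
(* Expanding this variance leaves a factor [N] to cancel, hence the separate case of an empty
   [C]. *)
have : 0 <= \sum_y (N * g y - S) ^+ 2 by apply: sumr_ge0 => y _; exact: sqr_ge0.
have -> : \sum_y (N * g y - S) ^+ 2 = N * (N * (\sum_y g y ^+ 2) - S ^+ 2).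
  have -> : \sum_y (N * g y - S) ^+ 2 =
      \sum_y (N ^+ 2 * g y ^+ 2 - (2 * N * S) * g y + S ^+ 2).
    by apply: eq_bigr => y _; ring.
  rewrite big_split sumrB -!mulr_sumr sumr_const -/S /= -[_ *+ _]mulr_natl -/N.
  ring.
have [C0|C0] := posnP #|C|.
  move=> _; have -> : S = 0.
    by rewrite /S big1 // => y; have := fintype0 y C0.
  by rewrite /N C0 mul0r expr0n.
by rewrite pmulr_rge0 ?ltr0n // subr_ge0.
Qed.

(* Only the failure events, not the query counts, are known to be measurable,
   so the averaging over the coins is applied to their indicators. *)
Lemma weighted_failure_bound (R : realType) (d : measure_display)
    (T : measurableType d) (P : probability T R) (I : finType)
    (a : I -> R) (F : I -> set T) (delta L : R) :
  (forall i, 0 <= a i) -> (forall i, measurable (F i)) ->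
  (forall i, (P (F i) <= delta%:E)%E) -> 0 <= L ->
  (forall w, L <= \sum_i a i * \1_(F i) w) ->
  L <= delta * \sum_i a i.
Proof.
move=> a0 mF PF L0 LF.
pose f i w : \bar R := ((a i)%:E * (\1_(F i) w)%:E)%E.
have mf i : measurable_fun setT (f i).
  apply: emeasurable_funM => //; apply/measurable_EFinP.
  exact: measurable_indic.
rewrite -lee_fin.
have -> : L%:E = (\int[P]_(w in setT) (cst L%:E) w)%E.
  rewrite integral_cst // -[LHS]mule1; congr (_ * _)%E.
  exact/esym/probability_setT.
apply: (@le_trans _ _ (\int[P]_(w in setT)
    (\sum_i f i w))%E).
  apply: ge0_le_integral => //.
  - exact: emeasurable_sum.
  - by move=> w _; rewrite /cst /f; under eq_bigr do rewrite -EFinM;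
      rewrite sumEFin lee_fin.
rewrite ge0_integral_sum //; last first.
  by move=> i w _; rewrite /f -EFinM lee_fin mulr_ge0.
rewrite mulr_sumr -sumEFin; apply: lee_sum => i _.
rewrite ge0_integralZl //; last 2 first.
- by apply/measurable_EFinP; exact: measurable_indic.
- by rewrite lee_fin.
rewrite integral_indic // setIT EFinM muleC.
apply: lee_wpmul2r; last exact: PF.
by rewrite lee_fin.
Qed.

Lemma failure_event (R : realType) (n m : nat) (p alpha eps delta : R)
    (k : nat) (d : measure_display) (T : measurableType d)
    (P : probability T R) (alg : T -> algo R n m) (A : 'I_m -> 'M[R]_n)
    (i : 'I_m) :
  solves_dynamic_trace p alpha eps delta k P alg -> dynamic_input p alpha A ->
  let F := [set w | ~ (`|estimate A (alg w) i - \tr (A i)| <= eps)]%classic in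
  measurable F /\ (P F <= delta%:E)%E.
Proof.
move=> [_ sol] dA F; have [mE PS] := sol A dA i.
set S := (X in P X) in PS.
have mS : measurable S.
  have -> : S = (setT `&` (fun w => estimate A (alg w) i) @^-1`
      [set` `[\tr (A i) - eps, \tr (A i) + eps]%R])%classic.
    rewrite setTI; apply/seteqP.
    by split => w; rewrite /S /= in_itv /= ler_distl.
  by apply: mE.
have -> : F = (~` S)%classic by [].
split; first exact: measurableC.
rewrite probability_setC // leeBlDr ?fin_num_measure //.
by rewrite -leeBlDl // -EFinB.
Qed.

(** * The bump inputs *)

(* Truncated subtraction makes the coefficient alpha * max(0, l - |t - c|). *)
Definition ramp_input (R : realType) (n m : nat) (alpha : R) (l c : nat)
    (u v : 'I_n) (t : 'I_m) : 'M[R]_n :=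
  (alpha * (l - (c - t) - (t - c))%N%:R) *: pair_proj R u v.
Arguments ramp_input {R n m}.

(** The norm of a multiple of the projection is the absolute coefficient; the tent function is at
    most [l] and changes by at most 1 per step. *)
Lemma ramp_input_dynamic (R : realType) (n m : nat) (p alpha : R) (l c : nat)
    (u v : 'I_n) :
  0 < p -> 0 <= alpha -> alpha * l%:R <= 1 -> u != v ->
  dynamic_input p alpha (ramp_input (m := m) alpha l c u v).
Proof.
move=> p0 a0 al uv.
have nE x : schatten_norm p (x *: pair_proj R u v) = `|x|.
  apply: schatten_norm_scaled_proj => //.
  - exact: pair_proj_sym.
  - exact: pair_proj_idem.
  - exact: pair_proj_trace.
split=> [t | t t' tt'].
  rewrite nE ger0_norm ?mulr_ge0 //; apply: le_trans al.
  by rewrite ler_wpM2l // ler_nat -subnDA leq_subr.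
rewrite /ramp_input -scalerBl nE -mulrBr normrM ger0_norm // -[leRHS]mulr1.
rewrite ler_wpM2l //; set x := (_ - _ - _)%N; set y := (_ - _ - _)%N.
have xy : (x <= y.+1)%N by rewrite /x /y; lia.
have yx : (y <= x.+1)%N by rewrite /x /y; lia.
move: xy yx; rewrite -2!(ler_nat R) -!natr1 => xy yx.
by rewrite ler_norml; lra.
Qed.

Lemma ramp_input_center (R : realType) (n m : nat) (alpha : R) (l : nat)
    (u v : 'I_n) (t : 'I_m) : u != v ->
  \tr (ramp_input alpha l t u v t) = alpha * l%:R.
Proof.
move=> uv; rewrite /ramp_input mxtraceZ pair_proj_trace //.
by rewrite mulr1 subnn !subn0.
Qed.

(** The bump lives on times at distance less than [l] from its center. After a shift by [l],
    division by [2 * l] numbers the disjoint blocks around the centers. *)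
Lemma ramp_input_off_block (R : realType) (n m : nat) (alpha : R) (l b : nat)
    (u v : 'I_n) (t : 'I_m) : (0 < l)%N ->
  ((t + l) %/ (2 * l))%N != b -> ramp_input alpha l (b * (2 * l)) u v t = 0.
Proof.
move=> l0 tb; rewrite /ramp_input.
suff -> : (l - (b * (2 * l) - t) - (t - b * (2 * l)) = 0)%N.
  by rewrite mulr0 scale0r.
apply/eqP; apply: contraNT tb => ne0; apply/eqP.
have -> : (t + l = b * (2 * l) + (t + l - b * (2 * l)))%N by lia.
by rewrite divnMDl; [rewrite divn_small; lia | lia].
Qed.

(** * Query lower bound summed over blocks *)

(** Only the zero-run queries inside block [b] need colouring: elsewhere the matrix is 0. A pair of
    equal colour thus gets only zero answers. *)
Lemma blind_pairs (R : realType) (n m k l b q : nat) (alpha : R)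
    (a : algo R n m) :
  (0 < l)%N -> legal k 0 a ->
  (count (fun jx : 'I_m * 'cV[R]_n => (jx.1 + l) %/ (2 * l) == b)
     (zero_queries a) <= q)%N ->
  n%:R ^+ 2 <= ((2 ^ k.+1).+1 ^ q)%N%:R *
    \sum_(u < n) \sum_(v < n)
      ((u == v) || (estimates (ramp_input alpha l (b * (2 * l)) u v) a ==
                    estimates (fun=> 0) a))%:R :> R.
Proof.
move=> l0 la; set pb := (X in count X); move=> cq.
pose s := [seq jx.2 | jx <- zero_queries a & pb jx].
have sP jx : List.In jx (zero_queries a) -> pb jx -> List.In jx.2 s.
  rewrite /s; elim: (zero_queries a) => //= jy r IH [<- ->|/IH{}IH pbx].
    by left.
  by case: ifP => _ /=; auto.
have sK x : List.In x s -> kbit_vector k x.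
  have := zero_queries_kbit la; rewrite /s; elim: (zero_queries a) => //=.
  move=> jy r IH kr; have {}IH := IH (fun jx h => kr jx (or_intror h)).
  by case: ifP => _ //= [<-|//]; apply: kr; left.
have [C [f [cardC fP]]] := kbit_coloring sK.
have := card_collisions R f; rewrite card_ord => /le_trans; apply.
have sq : (size s <= q)%N by rewrite size_map size_filter.
apply: ler_pM => //; first by do 2![apply: sumr_ge0 => ? _].
  by rewrite ler_nat cardC leq_pexp2l.
apply: ler_sum => u _; apply: ler_sum => v _.
have [fuv|_] := eqVneq (f u) (f v); last exact: ler0n.
rewrite estimates_blind ?eqxx ?orbT // => jx jxin.
have [pbx|pbx] := boolP (pb jx).
  rewrite /ramp_input -scalemxAl pair_proj_mul (fP _ _ fuv _ (sP _ jxin pbx)).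
  by rewrite subrr mulr0 scale0r scaler0.
by rewrite ramp_input_off_block // mul0mx.
Qed.

(** If [4 * Q < B * tau], then for all coins more than 3/4 of the blocks get fewer than [tau]
    queries in the zero run. Each such block yields failures of total weight at least [g], whereas
    averaging allows at most [delta * B%:R * (g + N ^+ 2)]. *)
Lemma block_bound (R : realType) (n m k l B Q tau : nat)
    (p alpha eps delta : R) (d : measure_display) (T : measurableType d)
    (P : probability T R) (alg : T -> algo R n m) :
  0 < p -> 0 <= alpha -> 0 < delta < 1 / 4 -> 1 <= n%:R * delta ->
  (0 < l)%N -> 2 * eps < alpha * l%:R <= 1 ->
  (forall b, (b < B)%N -> (b * (2 * l) < m)%N) ->
  (0 < tau)%N -> ((2 ^ k.+1).+1 ^ tau.-1)%N%:R * (3 * delta) <= 1 ->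
  solves_dynamic_trace p alpha eps delta k P alg ->
  query_bound p alpha alg Q -> (B * tau <= 4 * Q)%N.
Proof.
move=> p0 a0 /andP[d0 d4] nd l0 /andP[el al] cB tau0 Kd sol qb.
set K := ((2 ^ k.+1).+1 ^ tau.-1)%N in Kd.
have K0 : 0 < K%:R :> R by rewrite ltr0n expn_gt0.
have N0 : 0 < n%:R :> R.
  by rewrite -(pmulr_lgt0 _ d0); apply: lt_le_trans nd; rewrite ltr01.
have n4 : (4 < n)%N.
  by rewrite -(ltr_nat R) -(ltr_pM2r d0); apply: lt_le_trans nd; lra.
pose u0 : 'I_n := Ordinal (ltn_trans (isT : 0 < 4)%N n4).
pose u1 : 'I_n := Ordinal (ltn_trans (isT : 1 < 4)%N n4).
have zE : (fun=> 0) = ramp_input (m := m) alpha 0 0 u0 u1.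
  by apply/funext => t; rewrite /ramp_input sub0n mulr0 scale0r.
have dz : dynamic_input p alpha (fun _ : 'I_m => 0 : 'M[R]_n).
  by rewrite zE; apply: ramp_input_dynamic => //; rewrite mulr0 ler01.
rewrite leqNgt; apply/negP => QB.
have B0 : 0 < B%:R :> R by rewrite ltr0n; case: (B) QB.
(* [g] bounds from below the number of blind ordered pairs off the diagonal; the subtracted [N] is
   the diagonal. *)
pose N : R := n%:R; pose g : R := N ^+ 2 / K%:R - N.
have gN : 2 * delta * N ^+ 2 <= g.
  have : N ^+ 2 * (3 * delta) <= N ^+ 2 / K%:R.
    by rewrite ler_wpM2l ?sqr_ge0 // -[leRHS]mul1r ler_pdivlMr // mulrC.
  have : N <= N ^+ 2 * delta by rewrite expr2 -mulrA ler_peMr // ltW.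
  by rewrite /g; lra.
have g0 : 0 < g by apply: lt_le_trans gN; rewrite !mulr_gt0 // exprn_gt0.
pose c (b : 'I_B) : 'I_m := Ordinal (cB b (ltn_ord b)).
(* Failures are indexed by a block for the zero input, with weight [g], and by a block and an
   ordered pair for a bump, with weight 1 off the diagonal. *)
pose I := ('I_B + 'I_B * ('I_n * 'I_n))%type.
pose wt (i : I) : R :=
  match i with inl _ => g | inr i => (i.2.1 != i.2.2)%:R end.
pose A (b : 'I_B) u v : 'I_m -> 'M[R]_n := ramp_input alpha l (b * (2 * l)) u v.
pose F0 b : set T := [set w | ~ (`|estimate (fun=> 0) (alg w) (c b) -
                                    \tr (0 : 'M[R]_n)| <= eps)]%classic.
pose F1 b u v : set T := if u == v then set0 else
  [set w | ~ (`|estimate (A b u v) (alg w) (c b) -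
                \tr (A b u v (c b))| <= eps)]%classic.
pose F (i : I) := match i with inl b => F0 b | inr i => F1 i.1 i.2.1 i.2.2 end.
have mPF i : measurable (F i) /\ (P (F i) <= delta%:E)%E.
  case: i => [b | [b [u v]]] /=; first exact: (failure_event (c b) sol dz).
  rewrite /F1; have [_|uv] := eqVneq u v; first by rewrite measure0 lee_fin ltW.
  by apply: failure_event sol _; exact: ramp_input_dynamic.
pose L : R := g * (B%:R - Q%:R / tau%:R).
have t0 : 0 < tau%:R :> R by rewrite ltr0n.
have QBt : Q%:R / tau%:R < B%:R / 4 :> R.
  move: QB; rewrite -(ltr_nat R) !natrM => QB.
  by rewrite ltr_pdivrMr // mulrAC ltr_pdivlMr // mulrC.
have L0 : 0 <= L by rewrite /L mulr_ge0 ?(ltW g0) //; lra.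
have wt0 i : 0 <= wt i by case: i => [b | [b [u v]]] //=; exact: ltW.
have LF w : L <= \sum_i wt i * \1_(F i) w.
  pose q (b : 'I_B) :=
    count (fun jx : 'I_m * 'cV[R]_n => (jx.1 + l) %/ (2 * l) == b)%N
      (zero_queries (alg w)).
  have sq : (\sum_b q b <= Q)%N.
    apply: leq_trans (qb _ dz w); rewrite -size_zero_queries /q.
    elim: (zero_queries (alg w)) => [|jx r IH] /=; first by rewrite big1.
    rewrite big_split /=; apply: (@leq_add _ _ 1%N (size r)) => //.
    have [jB|jB] := ltnP ((jx.1 + l) %/ (2 * l)) B.
      rewrite (bigD1 (Ordinal jB)) //= eqxx big1 // => b bj.
      by case: eqP => // jb; case/eqP: bj; apply: val_inj.
    by rewrite big1 // => b _; rewrite gtn_eqF // (leq_trans (ltn_ord b) jB).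
  (* [1 - q b / tau] is at most 1 and is nonpositive on blocks with at least [tau] queries, so it is
     a linear lower bound for the indicator of a light block. *)
  have LS : L <= \sum_b g * (1 - (q b)%:R / tau%:R).
    rewrite /L -mulr_sumr ler_pM2l // sumrB sumr_const card_ord lerB //.
    by rewrite -mulr_suml ler_pM2r ?invr_gt0 // -natr_sum ler_nat.
  have -> : \sum_i wt i * \1_(F i) w = \sum_b (g * \1_(F0 b) w +
      \sum_u \sum_v (u != v)%:R * \1_(F1 b u v) w).
    rewrite big_sumType /= big_split /=; congr (_ + _).
    by under [RHS]eq_bigr do rewrite pair_bigA; rewrite pair_bigA.
  apply: (le_trans LS); apply: ler_sum => b _.
  set W := \sum_u _.
  have W0 : 0 <= W by do 2![apply: sumr_ge0 => ? _]; rewrite mulr_ge0.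
  have [qt|qt] := leqP tau (q b).
    apply: (@le_trans _ _ 0); last by rewrite addr_ge0 // mulr_ge0 // ltW.
    by rewrite pmulr_rle0 // subr_le0 ler_pdivlMr // mul1r ler_nat.
  apply: (@le_trans _ _ g).
    by rewrite ger_pMr // gerBl divr_ge0.
  (* Either the zero run fails and already pays [g], or its estimate is at most [eps] in absolute
     value. *)
  rewrite indicE; have [_|wF] := boolP (w \in _); first by rewrite mulr1 lerDl.
  rewrite mulr0 add0r.
  have est0 : `|estimate (fun=> 0) (alg w) (c b)| <= eps.
    have := wF; rewrite notin_setE /F0 /= mxtrace0 subr0.
    by move=> /contrapT.
  pose e u v := estimates (A b u v) (alg w) == estimates (fun=> 0) (alg w).
  have bp : N ^+ 2 / K%:R <= \sum_(u < n) \sum_(v < n) ((u == v) || e u v)%:R.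
    rewrite ler_pdivrMr // mulrC; apply: blind_pairs => //; first exact: sol.1.
    by rewrite -ltnS prednK.
  have diag : N = \sum_(u < n) \sum_(v < n) (u == v)%:R.
    under eq_bigr => u _.
      rewrite (bigD1 u) //= eqxx big1 ?addr0; last first.
        by move=> v /negPf; rewrite eq_sym => ->.
      over.
    by rewrite sumr_const card_ord.
  rewrite /g lerBlDr; apply: (le_trans bp).
  rewrite [X in _ + X]diag /W -big_split /=.
  apply: ler_sum => u _; rewrite -big_split /=; apply: ler_sum => v _.
  have [uv|uv] := eqVneq u v; first by rewrite mul0r add0r.
  rewrite /F1 (negPf uv).
  rewrite addr0 mul1r /e /=; case: eqP => [eE|_]; last by rewrite ler0n.
  rewrite indicE mem_set //= /estimate eE -/(estimate _ _ _) => far.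
  (* One number cannot be within [eps] of both 0 and [alpha * l%:R], which exceeds [2 * eps]. *)
  have cE : \tr (A b u v (c b)) = alpha * l%:R.
    exact: (ramp_input_center alpha l (c b) uv).
  by move: far est0; rewrite cE !ler_norml; lra.
have := weighted_failure_bound wt0 (fun i => (mPF i).1) (fun i => (mPF i).2)
  L0 LF.
have wtS : \sum_i wt i <= B%:R * (g + N ^+ 2).
  rewrite big_sumType /= mulrDr; apply: lerD.
    by rewrite sumr_const card_ord mulr_natl.
  apply: (@le_trans _ _ (\sum_(i in {: 'I_B * ('I_n * 'I_n)}) 1)).
    by apply: ler_sum => -[b [u v]] _; rewrite lern1 leq_b1.
  by rewrite sumr_const !card_prod !card_ord !natrM expr2.
move=> Lle; have {}Lle := le_trans Lle (ler_wpM2l (ltW d0) wtS).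
have : g * (B%:R * (3 / 4)) < B%:R * (delta * (g + N ^+ 2)).
  rewrite [ltRHS]mulrCA; apply: lt_le_trans Lle; rewrite /L ltr_pM2l //; lra.
rewrite [ltLHS]mulrCA ltr_pM2l //; apply/negP; rewrite -leNgt.
(* The contradiction comes from [delta < 1 / 4] and [delta * N ^+ 2 <= g / 2]. *)
have : g * (1 / 2) <= g * (3 / 4 - delta) by rewrite ler_pM2l //; lra.
lra.
Qed.

(** * Logarithmic estimates and the threshold *)

(** From exp(-1/3) >= 2/3 follows e <= 27/8 < 4. This makes [ln (ln 4)] positive. *)
Lemma ln4_gt1 (R : realType) : 1 < ln 4 :> R.
Proof.
rewrite -ltr_expR lnK ?posrE //.
have e13 : expR (3^-1 : R) <= 3 / 2.
  rewrite -[leLHS]invrK -expRN -[leRHS]invrK lef_pV2 ?posrE ?expR_gt0 //.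
  by apply: le_trans (expR_ge1Dx _); rewrite invf_div; lra.
have -> : expR (1 : R) = expR (3^-1) ^+ 3 by rewrite -expRM_natl divff.
apply: (@le_lt_trans _ _ ((3 / 2) ^+ 3)); last by lra.
by rewrite lerXn2r // nnegrE ?expR_ge0 //; lra.
Qed.

(** With [y = 1 / (3 * delta)] the claim is [3 * y <= y ^+ 5], true since [y >= 4 / 3] and (4/3)^4 =
    256/81 > 3. *)
Lemma ln_inv_le5 (R : realType) (delta : R) : 0 < delta < 1 / 4 ->
  ln (1 / delta) <= 5 * ln (1 / (3 * delta)).
Proof.
move=> /andP[d0 d4]; set y := 1 / (3 * delta).
have y43 : 4 / 3 <= y by rewrite ler_pdivlMr ?mulr_gt0 //; lra.
have y0 : 0 < y by lra.
have -> : 1 / delta = 3 * y by rewrite /y; field; rewrite gt_eqF.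
have y30 : 0 < 3 * y by lra.
rewrite [leRHS]mulr_natl -lnXn // ler_ln ?posrE ?exprn_gt0 //.
rewrite exprSr ler_pM2r //.
apply: (@le_trans _ _ ((4 / 3) ^+ 4)); first by lra.
by rewrite lerXn2r ?nnegrE //; lra.
Qed.

(* tau is the largest number with K^(1-tau) >= 3 delta, so that blocks with
   fewer than tau queries have too many blind pairs (u, v). *)
Lemma query_threshold (R : realType) (delta : R) (k : nat) :
  0 < delta < 1 / 4 -> exists2 tau : nat, (0 < tau)%N &
  ((2 ^ k.+1).+1 ^ tau.-1)%N%:R * (3 * delta) <= 1 /\
  ln (1 / delta) <= 10 * tau%:R * (k.+1)%:R.
Proof.
move=> dd; have /andP[d0 d4] := dd; set K := (2 ^ k.+1).+1.
have d3 : 0 < 3 * delta by rewrite mulr_gt0.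
have K1 : (1 < K)%N by rewrite ltnS expn_gt0.
have ex : exists t, 1 < (K ^ t)%N%:R * (3 * delta).
  exists (Num.trunc (1 / (3 * delta))).+1.
  have /andP[_ tr] := truncn_itv (divr_ge0 ler01 (ltW d3)).
  rewrite -ltr_pdivrMr //; apply: lt_trans tr _.
  by rewrite ltr_nat ltn_expl.
case: (ex_minnP ex) => tau Ktau tau_min; exists tau.
  by case: tau Ktau {tau_min} => //; rewrite expn0 mul1r; lra.
split.
  rewrite leNgt; apply/negP => /tau_min; case: tau Ktau {tau_min} => [|tau] /=.
    by rewrite expn0 mul1r; lra.
  by rewrite ltnn.
have lnK : ln K%:R <= 2 * (k.+1)%:R :> R.
  (* [K <= 3 ^ k.+1] together with ln 3 <= 2 gives the factor 2, which turns the 5 of [ln_inv_le5]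
     into 10. *)
  have K3 : (K <= 3 ^ k.+1)%N.
    rewrite /K; elim: (k) => // j IH; rewrite expnS (expnS 3).
    by move: IH; move: (2 ^ _)%N (3 ^ _)%N => x y; lia.
  apply: (@le_trans _ _ (ln (3 ^+ k.+1))).
    by rewrite ler_ln ?posrE ?exprn_gt0 ?ltr0n // -natrX ler_nat.
  rewrite lnXn // -[leLHS]mulr_natr ler_wpM2r //.
  by rewrite (_ : 3 = 1 + 2) ?le_ln1Dx //; lra.
apply: (le_trans (ln_inv_le5 dd)).
have : ln (1 / (3 * delta)) <= tau%:R * ln K%:R.
  rewrite [leRHS]mulr_natl -lnXn ?ltr0n //.
  rewrite ler_ln ?posrE ?exprn_gt0 ?divr_gt0 ?ltr0n //.
  by rewrite ler_pdivrMr // -natrX ltW.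
have : tau%:R * ln K%:R <= tau%:R * (2 * (k.+1)%:R) :> R by rewrite ler_wpM2l.
lra.
Qed.

(** * Choice of parameters and conclusion *)

(** [B] is the ceiling of [m / h], the number of multiples of [h] below [m]. *)
Lemma block_count (m h : nat) : (0 < h)%N ->
  exists2 B, (m <= B * h)%N & forall b, (b < B)%N -> (b * h < m)%N.
Proof.
move=> h0; exists ((m + h.-1) %/ h)%N => [|b]; last first.
  by rewrite leq_divRL //; lia.
by have := ltn_ceil (m + h.-1) h0; rewrite mulSn; lia.
Qed.

Theorem theorem5p4 (R : realType) :
  exists2 c : R, 0 < c &
  forall delta : R, 0 < delta < 1 / 4 ->
  exists n0 : nat, forall n : nat, (n0 <= n)%N ->
  forall p eps alpha : R, 1 <= p <= 2 -> 0 < eps < 1 / 4 -> 0 <= alpha < 1 ->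
  forall (m k : nat) (d : measure_display) (T : measurableType d)
    (P : probability T R) (alg : T -> algo R n m) (Q : nat),
  solves_dynamic_trace p alpha eps delta k P alg ->
  query_bound p alpha alg Q ->
  c * (m%:R * Num.min 1 (alpha / eps) *
       (ln (1 / delta) / (k%:R + ln (ln (1 / delta))))) <= Q%:R.
Proof.
(* [c2] absorbs [k.+1] into the denominator [k%:R + ln L], and 240 = 6 * 10 * 4 collects the factors
   of [mmin], [Ltau] and [BQ]. *)
pose c2 : R := Num.min 1 (ln (ln 4)).
have c20 : 0 < c2 by rewrite lt_min ltr01 ln_gt0 // ln4_gt1.
have h240 : 0 < 240 :> R by rewrite ltr0n.
exists (c2 / 240); first exact: divr_gt0.
move=> delta dd; have /andP[d0 d4] := dd.
exists (Num.trunc (1 / delta)).+1 => n nn p eps alpha /andP[p1 _] /andP[e0 e4].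
move=> /andP[a0 a1] m k d T P alg Q sol qb.
have nd : 1 <= n%:R * delta.
  have /andP[_ tr] := truncn_itv (divr_ge0 ler01 (ltW d0)).
  rewrite -ler_pdivrMr // ltW //; apply: lt_le_trans tr _.
  by rewrite ler_nat.
have [alpha0|alpha0] := eqVneq alpha 0.
  by rewrite alpha0 mul0r (min_r ler01) mulr0 mul0r mulr0.
have {a0 alpha0} a0 : 0 < alpha by rewrite lt_neqAle eq_sym alpha0.
have [tau tau0 [Ktau Ltau]] := query_threshold k dd.
(* The least [l] with [alpha * l%:R > 2 * eps]. *)
pose l := (Num.trunc (2 * eps / alpha)).+1.
have lE : l%:R = (Num.trunc (2 * eps / alpha))%:R + 1 :> R by rewrite natr1.
have /andP[ll lu] : l%:R - 1 <= 2 * eps / alpha < l%:R.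
  rewrite {1}lE addrK; apply: truncn_itv.
  by rewrite divr_ge0 ?mulr_ge0 // ltW.
have el : 2 * eps < alpha * l%:R by rewrite [ltRHS]mulrC -ltr_pdivrMr.
have lal : alpha * (l%:R - 1) <= 2 * eps.
  by rewrite [leLHS]mulrC -ler_pdivlMr.
(* If [alpha <= 2 * eps], the height is at most [2 * eps + alpha <= 4 * eps < 1]; otherwise [l = 1]
   and the height is [alpha]. *)
have al : alpha * l%:R <= 1.
  have [ae|ae] := leP alpha (2 * eps); first by lra.
  have ea1 : 2 * eps / alpha < 1 by rewrite ltr_pdivrMr // mul1r.
  have l1 : (l < 2)%N by rewrite -(ltr_nat R); lra.
  have : alpha * l%:R <= alpha * 1 by rewrite ler_pM2l // lern1.
  by lra.
have [B mB cB] := block_count m (isT : 0 < 2 * l)%N.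
have BQ : (B * tau <= 4 * Q)%N.
  apply: (@block_bound R n m k l B Q tau p alpha eps delta d T P alg) => //.
  - by apply: lt_le_trans p1; rewrite ltr01.
  - exact: ltW.
  - by rewrite el al.
have mmin : m%:R * Num.min 1 (alpha / eps) <= 6 * B%:R.
  set mu := Num.min _ _.
  have mu1 : mu <= 1 by rewrite ge_min lexx.
  have mu0 : 0 <= mu by rewrite le_min ler01 divr_ge0 // ltW.
  have mue : mu * eps <= alpha by rewrite -ler_pdivlMr // ge_min lexx orbT.
  (* [mu * (l%:R - 1)] is at most 2 and [mu] at most 1; blocks of length [2 * l] then give the
     factor 6. *)
  have mul : mu * l%:R <= 3.
    have : mu * (l%:R - 1) <= mu * (2 * eps / alpha) by rewrite ler_wpM2l.
    have -> : mu * (2 * eps / alpha) = 2 * (mu * eps / alpha) by ring.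
    have : mu * eps / alpha <= 1 by rewrite ler_pdivrMr // mul1r.
    lra.
  have : m%:R * mu <= (B * (2 * l))%N%:R * mu by rewrite ler_wpM2r // ler_nat.
  move=> /le_trans; apply.
  rewrite !natrM; have : B%:R * (mu * l%:R) <= B%:R * 3 by rewrite ler_wpM2l.
  lra.
set L := ln (1 / delta) in Ltau *.
have d4i : 4 <= 1 / delta by rewrite ler_pdivlMr //; lra.
have L4 : ln 4 <= L by rewrite ler_ln ?posrE ?divr_gt0.
have L1 : 1 < L := lt_le_trans (ln4_gt1 R) L4.
have den : c2 * (k.+1)%:R <= k%:R + ln L.
  have : c2 <= ln L.
    apply: (@le_trans _ _ (ln (ln 4))); first by rewrite ge_min lexx orbT.
    rewrite ler_ln ?posrE //; first exact: lt_trans ltr01 (ln4_gt1 R).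
    exact: lt_trans ltr01 L1.
  have : c2 * k%:R <= 1 * k%:R by rewrite ler_wpM2r // ge_min lexx.
  by rewrite -natr1; lra.
have den0 : 0 < k%:R + ln L by apply: lt_le_trans den; rewrite mulr_gt0.
have frac : L / (k%:R + ln L) <= 10 * tau%:R / c2.
  rewrite ler_pdivrMr // mulrAC ler_pdivlMr //.
  apply: (@le_trans _ _ (10 * tau%:R * (c2 * (k.+1)%:R))).
    by rewrite mulrCA [leLHS]mulrC ler_pM2l.
  by rewrite ler_wpM2l ?mulr_ge0.
have prod : m%:R * Num.min 1 (alpha / eps) * (L / (k%:R + ln L)) <=
    6 * B%:R * (10 * tau%:R / c2).
  apply: ler_pM => //.
    by rewrite mulr_ge0 // le_min ler01 divr_ge0 // ltW.
  by rewrite divr_ge0 // ltW // (lt_trans ltr01).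
have := ler_wpM2l (ltW (divr_gt0 c20 h240)) prod.
move=> /le_trans; apply.
have -> : c2 / 240 * (6 * B%:R * (10 * tau%:R / c2)) = (B * tau)%N%:R / 4.
  by rewrite natrM; field; rewrite gt_eqF.
by move: BQ; rewrite -(ler_nat R) !natrM; lra.
Qed.
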